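(* Let $G$ be a connected finite simple graph with $n$ vertices and $m$ edges, and let $$p_m(t)=-1+\sum_{i=0}^m a_it^i$$ be the polynomial integrand in Steele's formula for the expected length of the minimal spanning tree of $G$. Then $$a_3=c_3,\qquad a_4=c_4,\qquad a_5=c_5-k_3^5,\qquad a_6=c_6+2k_4-c_{5,1}-k_{3,2}.$$
   Context: For a finite simple graph $H$, the rank is $r(H)=|V(H)|-k(H)$, where $k(H)$ is the number of connected components of $H$. For a finite simple graph $G$, $S(G)$ denotes the set of spanning subgraphs of $G$ (subgraphs with vertex set $V(G)$ and edge set any subset of $E(G)$). The Tutte polynomial of $G$ is $$T(G;x,y)=\sum_{A\in S(G)}(x-1)^{r(G)-r(A)}(y-1)^{|E(A)|-r(A)},$$ and $T_x$ denotes its partial derivative with respect to $x$. Steele's formula says that, for a connected graph $G$ whose edges have independent lengths uniform on $[0,1]$, the expected total length of a minimal spanning tree is $\int_0^1\frac{1-t}{t}\,\frac{T_x(G;\frac1t,\frac1{1-t})}{T(G;\frac1t,\frac1{1-t})}\,dt$. The polynomial integrand $p_m(t)$, where $m=|E(G)|$, is the polynomial (of degree at most $m$) that agrees with $\frac{1-t}{t}\,\frac{T_x(G;\frac1t,\frac1{1-t})}{T(G;\frac1t,\frac1{1-t})}$ for $t\in(0,1)$. The numbers $a_i$ are defined by $p_m(t)=-1+\sum_{i=0}^m a_it^i$, i.e. $a_i$ is the coefficient of $t^i$ in $p_m(t)+1$; by convention $a_i=0$ for $i>m$. Counts of subgraphs of $G$ (all subgraphs are ordinary, not necessarily induced, subgraphs):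 - $c_i$ is the number of cycles of size (length) $i$ in $G$. - $k_3^5$ is the number of spanning subgraphs $A\in S(G)$ with exactly $5$ edges and rank $3$ (equivalently, the number of subgraphs of $G$ consisting of a $4$-cycle together with one chord). - $c_{5,1}$ is the number of cycles of size $5$ with one chord, i.e. the number of subgraphs of $G$ consisting of a $5$-cycle together with exactly one chord of it. - $k_4$ is the number of complete subgraphs $K_4$ in $G$. - $k_{3,2}$ is the number of subgraphs of $G$ isomorphic to the complete bipartite graph $K_{3,2}$. *)

(* Defs.v *)
From HB Require Import structures.
From mathcomp Require Import all_boot all_order all_algebra.
From mathcomp Require Import boolp classical_sets.

Set Implicit Arguments.
Unset Strict Implicit.
Unset Printing Implicit Defensive.

Import GRing.Theory Num.Theory.
Local Open Scope ring_scope.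

(* Finite simple graphs *)

Record sgraph := SGraph {
  vertex :> finType;
  adj : rel vertex;
  adj_sym : symmetric adj;
  adj_irr : irreflexive adj }.

Definition edges (G : sgraph) : {set {set G}} :=
  [set [set x; y] | x in [set: G], y in [set: G] & adj x y].

Definition connected (G : sgraph) : Prop :=
  (0 < #|G|)%N /\ forall x y : G, connect (@adj G) x y.

(* S(G): a spanning subgraph is given by its edge set. *)
Definition spanning (G : sgraph) : {set {set {set G}}} := powerset (edges G).

Definition comps (G : sgraph) (A : {set {set G}}) : nat :=
  n_comp [rel x y : G | [set x; y] \in A] predT.

Definition rk (G : sgraph) (A : {set {set G}}) : nat := (#|G| - comps A)%N.

(* T(G; x, y) as an element of R[y][x]: the outer variable 'X is x and the
   inner one 'Y = 'X%:P is y, so that T.[a, b] = T(G; a, b) and the formal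
   derivative T^`() is the partial derivative T_x.  The truncated
   subtractions are exact, as rk A <= rk (edges G) and rk A <= #|A|. *)
Definition tutte (R : comNzRingType) (G : sgraph) : {poly {poly R}} :=
  \sum_(A in spanning G)
    ('X - 1) ^+ (rk (edges G) - rk A) * ('Y - 1) ^+ (#|A| - rk A).

Definition steele_integrand (R : fieldType) (G : sgraph) (t : R) : R :=
  (1 - t) / t * ((tutte R G)^`().[t^-1, (1 - t)^-1]
                  / (tutte R G).[t^-1, (1 - t)^-1]).

Definition is_polynomial_integrand (R : realFieldType) (G : sgraph)
    (p : {poly R}) : Prop :=
  (size p <= #|edges G|.+1)%N /\
  forall t : R, 0 < t < 1 -> p.[t] = steele_integrand G t.

(* p_m: for connected G exactly one polynomial satisfies the predicate (it is
   unique because R is infinite); the default value 0 is then irrelevant. *)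
Definition polynomial_integrand (R : realFieldType) (G : sgraph) : {poly R} :=
  xget 0 (fun p : {poly R} => is_polynomial_integrand G p).

(* a_i, where p_m(t) = -1 + sum_i a_i t^i *)
Definition mst_coef (R : realFieldType) (G : sgraph) (i : nat) : R :=
  (polynomial_integrand R G + 1)`_i.

(* Counting (not necessarily induced) subgraphs.  A subgraph is a pair
   (vertex set, edge set). *)

Definition is_subgraph (G : sgraph) (S : {set G} * {set {set G}}) : bool :=
  (S.2 \subset edges G) && [forall a in S.2, a \subset S.1].

Definition sub_iso (H G : sgraph) (S : {set G} * {set {set G}}) : bool :=
  [exists f : {ffun H -> G},
    [&& injectiveb f, S.1 == f @: [set: H]
      & S.2 == [set f @: (a : {set H}) | a in edges H]]].

Definition copies (H G : sgraph) : {set {set G} * {set {set G}}} :=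
  [set S | is_subgraph S && sub_iso H S].

(* The cycle C_n (meaningful for n >= 3) on the vertices 0, ..., n - 1 *)
Definition cycle_adj n : rel 'I_n :=
  [rel i j : 'I_n |
    (i != j) && ((j == i.+1 %% n :> nat) || (i == j.+1 %% n :> nat))%N].

Fact cycle_adj_sym n : symmetric (@cycle_adj n).
Proof. by move=> i j; rewrite /cycle_adj /= eq_sym orbC. Qed.

Fact cycle_adj_irr n : irreflexive (@cycle_adj n).
Proof. by move=> i; rewrite /cycle_adj /= eqxx. Qed.

Definition cycle_graph n : sgraph :=
  SGraph (@cycle_adj_sym n) (@cycle_adj_irr n).

Definition complete_adj n : rel 'I_n := [rel i j : 'I_n | i != j].

Fact complete_adj_sym n : symmetric (@complete_adj n).
Proof. by move=> i j; rewrite /complete_adj /= eq_sym. Qed.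

Fact complete_adj_irr n : irreflexive (@complete_adj n).
Proof. by move=> i; rewrite /complete_adj /= eqxx. Qed.

Definition complete_graph n : sgraph :=
  SGraph (@complete_adj_sym n) (@complete_adj_irr n).

Definition bipartite_adj m n : rel ('I_m + 'I_n)%type :=
  fun u v => match u, v with
             | inl _, inr _ | inr _, inl _ => true
             | _, _ => false
             end.

Fact bipartite_adj_sym m n : symmetric (@bipartite_adj m n).
Proof. by move=> [i|i] [j|j]. Qed.

Fact bipartite_adj_irr m n : irreflexive (@bipartite_adj m n).
Proof. by move=> [i|i]. Qed.

Definition complete_bipartite m n : sgraph :=
  SGraph (@bipartite_adj_sym m n) (@bipartite_adj_irr m n).

(* c_i *)
Definition num_cycles (G : sgraph) (i : nat) : nat :=
  #|copies (cycle_graph i) G|.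

(* k_3^5 *)
Definition num_k35 (G : sgraph) : nat :=
  #|[set A in spanning G | ((#|A| == 5) && (rk A == 3))%N]|.

(* c_{5,1}: an edge of G joining two vertices of a cycle and not belonging to
   the cycle is a chord of it. *)
Definition num_c51 (G : sgraph) : nat :=
  #|[set S : {set G} * {set {set G}} |
      [exists C in copies (cycle_graph 5) G, exists a in edges G :\: C.2,
        (a \subset C.1) && (S == (C.1, a |: C.2))]]|.

(* k_4 *)
Definition num_k4 (G : sgraph) : nat := #|copies (complete_graph 4) G|.

(* k_{3,2} *)
Definition num_k32 (G : sgraph) : nat := #|copies (complete_bipartite 3 2) G|.

(* Main.v *)
Require Import Defs.
From HB Require Import structures.
From mathcomp Require Import all_boot all_order all_algebra.
From mathcomp Require classical_sets.
From mathcomp Require Import ring zify.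

Set Implicit Arguments.
Unset Strict Implicit.
Unset Printing Implicit Defensive.

Import Order.TTheory GRing.Theory Num.Theory.
Local Open Scope ring_scope.

(* Expanding T and T_x, Steele's integrand equals
   sum_A (r(G) - r(A)) t^|A| (1 - t)^(m - |A|), so for i > 0 the coefficient
   a_i is minus the sum over the edge sets B with |B| = i of
   sum_(A <= B) (-1)^(|B| - |A|) r(A).  This alternating sum vanishes as soon as
   B has a vertex of degree 1, since deleting a pendant edge always lowers the
   rank by exactly 1.  If B has no such vertex, then it covers at most |B| <= 6
   vertices, and relabelling these as 0, 1, ... leaves finitely many cases,
   which are evaluated: the only nonzero contributions come from cycles, K_4
   minus an edge, K_4, the 5-cycle with a chord, and K_{3,2}. *)

(** The point (1/t, 1/(1-t)) lies on the hyperbola (x-1)(y-1) = 1, where T collapses to (x-1)^r(G)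
    (1-t)^(-m); this is why the quotient is a polynomial in t. The values come from the beta
    invariant: minus the alternating sum over B is (-1)^(nullity - 1) beta(B). Beta is 1 for cycles
    and for theta graphs (K_4 minus an edge, the 5-cycle with a chord, K_{3,2}), 2 for K_4 and 0
    when the cycle matroid is disconnected; nullities 1, 2, 3 give the signs +, -, +. None of this
    theory is developed here; the values are evaluated. Every count in the formula for a_i concerns
    subgraphs with exactly i edges, so both sides are sums over the edge sets B of size i and are
    compared for each B separately. The obstacle is to make both summands computable: [rk] is
    defined through connected components of an abstract graph, and copies through injections into
    it. The rank is therefore carried by label tables, and the existence of a spanning copy by a
    search over permutations. Running through all labelled graphs makes isomorphism classes
    unnecessary. *)

(** * Rank of a list of edges *)

(* [label s z] is a representative of the component of [z] in the graph with
   edge list [s]. *)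
Fixpoint label (T : eqType) (s : seq (T * T)) (z : T) : T :=
  if s is e :: s' then
    if label s' z == label s' e.1 then label s' e.2 else label s' z
  else z.

Fixpoint label_rank (T : eqType) (s : seq (T * T)) : nat :=
  if s is e :: s' then
    (label_rank s' + (label s' e.1 != label s' e.2))%N
  else 0.

Definition edge_set (T : finType) (s : seq (T * T)) : {set {set T}} :=
  [set [set e.1; e.2] | e in s].

Lemma edge_set_cons (T : finType) (e : T * T) s :
  edge_set (e :: s) = [set e.1; e.2] |: edge_set s.
Proof.
apply/setP=> b; rewrite !inE; apply/imsetP/orP.
  by case=> e'; rewrite inE => /predU1P[->|es] ->; [left|right; apply: imset_f].
case=> [/eqP->|/imsetP[e' es ->]]; first by exists e; rewrite ?mem_head.
by exists e'; rewrite // inE es orbT.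
Qed.

Lemma edge_set_nil (T : finType) : edge_set [::] = set0 :> {set {set T}}.
Proof. by apply/setP=> b; rewrite inE; apply/imsetP=> -[]. Qed.

Section LabelRank.
Variable G : sgraph.
Implicit Types (s : seq (G * G)) (x y z : G) (A B : {set {set G}}).

Let E A := [rel x y : G | [set x; y] \in A].

Lemma connect_edges_sym A : connect_sym (E A).
Proof. by apply: sym_connect_sym => x y /=; rewrite setUC. Qed.

Lemma connect_label s z : connect (E (edge_set s)) z (label s z).
Proof.
elim: s z => [|e s IHs] z; first exact: connect0.
have sub x y : connect (E (edge_set s)) x y ->
    connect (E (edge_set (e :: s))) x y.
  apply: connect_sub => {}x {}y /= xy.
  by apply: connect1; rewrite /= edge_set_cons !inE xy orbT.
rewrite [label _ _]/=; case: eqP => [eq_z|_]; last exact/sub/IHs.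
apply: (connect_trans (sub _ _ (IHs z))); rewrite eq_z.
apply: (@connect_trans _ _ e.1).
  by rewrite connect_edges_sym; apply/sub/IHs.
apply: (@connect_trans _ _ e.2); last exact/sub/IHs.
by apply: connect1; rewrite /= edge_set_cons setU11.
Qed.

Lemma eq_label s e : e \in s -> label s e.1 = label s e.2.
Proof.
elim: s => //= e' s IHs; rewrite inE => /predU1P[->|/IHs ->//].
by rewrite eqxx; case: eqP.
Qed.

(** Labels are constant along edges, hence along paths; conversely, every vertex is connected to its
    label. *)
Lemma connect_edges_label s x y :
  connect (E (edge_set s)) x y = (label s x == label s y).
Proof.
apply/idP/eqP => [|eq_xy]; last first.
  apply: connect_trans (connect_label s x) _.
  by rewrite eq_xy connect_edges_sym; apply: connect_label.
case/connectP=> p; elim: p x => [|z p IHp] x /=; first by move=> _ ->.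
case/andP=> xz pz yz; rewrite -(IHp z pz yz).
case/imsetP: xz => e /eq_label es /setP exz.
have := exz x; have := exz z; rewrite !inE !eqxx orbT /=.
by do 2![move=> /esym/orP[]/eqP ->]; rewrite ?es.
Qed.

Lemma label_idem s z : label s (label s z) = label s z.
Proof.
by apply/esym/eqP; rewrite -connect_edges_label connect_label.
Qed.

(** The fixed points of [label s] are the representatives. An edge between two classes retires
    exactly one of them, [label s e.1]; any other edge retires none. *)
Lemma card_label_fixed s :
  (#|[set z | label s z == z]| + label_rank s)%N = #|G|.
Proof.
elim: s => [|e s <-] /=.
  by rewrite addn0 -cardsT; apply: eq_card => z; rewrite !inE eqxx.
rewrite addnCA addnC; congr (_ + _)%N.
have [eq_e|neq_e] := eqVneq (label s e.1) (label s e.2);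
  rewrite /= ?addn0 ?addn1.
  by apply: eq_card => z; rewrite !inE; case: (label s z =P _) => // ->;
    rewrite eq_e.
rewrite [RHS](cardsD1 (label s e.1)) inE label_idem eqxx add1n.
congr _.+1; apply: eq_card => z; rewrite !inE.
case: (eqVneq (label s z)) => [eqz|neqz].
  have [eq2|neq2] /= := eqVneq (label s e.2) z.
    by case/eqP: neq_e; rewrite -eqz -eq2 label_idem.
  by rewrite eqz; case: eqVneq.
by case: (eqVneq z) => // eqz; move: neqz; rewrite eqz label_idem eqxx.
Qed.

Lemma comps_edge_set s : (comps (edge_set s) + label_rank s)%N = #|G|.
Proof.
rewrite -(card_label_fixed s); congr (_ + _)%N; rewrite /comps /n_comp_mem.
(* Both [roots] and the fixed points of [label s] pick one vertex per component, so [label s] maps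
   the former bijectively onto the latter. *)
have <- : label s @: [set x | roots (E (edge_set s)) x]
    = [set z | label s z == z].
  apply/setP=> z; rewrite inE; apply/imsetP/eqP => [[x _ ->]|eqz].
    exact: label_idem.
  exists (fingraph.root (E (edge_set s)) z).
    by rewrite inE; apply: roots_root; apply: connect_edges_sym.
  by rewrite -{1}eqz; apply/eqP; rewrite -connect_edges_label connect_root.
rewrite card_in_imset => [|x y]; last first.
  rewrite !inE => /eqP rx /eqP ry /eqP; rewrite -connect_edges_label.
  move/(fingraph.rootP (@connect_edges_sym _)).
  by rewrite rx ry.
by apply: eq_card => x; rewrite !inE andbT.
Qed.

(** Loops and repetitions in the list are harmless, since the ends of such an edge already share a
    label. Concatenated lists can thus represent unions. *)
Lemma rk_edge_set s : rk (edge_set s) = label_rank s.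
Proof. by rewrite /rk -(comps_edge_set s) addKn. Qed.

End LabelRank.

(** * Alternating sums over subsets *)

Section SubsetSums.
Variable T : finType.
Implicit Types (A B E : {set T}) (b : T).

Lemma sum_powersetU1 (V : nmodType) (F : {set T} -> V) b B : b \notin B ->
  \sum_(A in powerset (b |: B)) F A
    = \sum_(A in powerset B) F (b |: A) + \sum_(A in powerset B) F A.
Proof.
move=> nbB; rewrite (bigID (fun A : {set T} => b \in A)) /=; congr (_ + _).
  rewrite (reindex_onto (fun A => b |: A) (fun A => A :\ b)) /=; last first.
    by move=> A /andP[_ bA]; rewrite setD1K.
  apply: eq_bigl => A; rewrite !inE eqxx andbT subUset sub1set setU11 /=.
  have [sAB|nsAB] := boolP (A \subset B).
    rewrite (subset_trans sAB (subsetUr _ _)) setU1K ?eqxx //.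
    by apply: contra nbB; apply: subsetP.
  apply/negbTE; apply: contra nsAB => /andP[sA /eqP<-].
  by rewrite subDset subUset sub1set setU11.
apply: eq_bigl => A; rewrite !inE; apply/andP/idP=> [[sA nbA]|sAB].
  by apply/subsetP=> x xA; have /setU1P[eqx|//] := subsetP sA x xA;
    rewrite -eqx xA in nbA.
split; first exact: subset_trans sAB (subsetUr _ _).
by apply: contra nbB; apply: subsetP.
Qed.

(** The binomial theorem, one term per subset. It serves with x + y = 1 to collapse T, with x + y =
    0 for alternating sums of constants, and to expand the powers of 1 - 'X. *)
Lemma sum_powerset_expr (R : comPzRingType) (x y : R) B :
  \sum_(A in powerset B) x ^+ #|A| * y ^+ (#|B| - #|A|) = (x + y) ^+ #|B|.
Proof.
have [k] := ubnP #|B|; elim: k B => // k IHk B.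
have [->|[b bB]] := set_0Vmem B.
  by rewrite powerset0 big_set1 cards0 subnn !expr0 mulr1.
rewrite ltnS -{2 3 4}(setD1K bB) (cardsD1 b B) bB => ltBk.
have nb : b \notin B :\ b by rewrite !inE eqxx.
rewrite sum_powersetU1 // cardsU1 nb add1n exprS mulrDl -IHk // !mulr_sumr.
congr (_ + _); apply: eq_bigr => A; rewrite inE => sA.
  rewrite cardsU1 (contraNN (subsetP sA b) nb) add1n subSS exprS.
  by rewrite mulrA.
by rewrite subSn ?subset_leq_card // exprS mulrCA.
Qed.

Lemma sum_supersets (V : nmodType) (F : nat -> V) A E : A \subset E ->
  \sum_(D in powerset (E :\: A)) F #|D|
    = \sum_(B in powerset E | A \subset B) F (#|B| - #|A|)%N.
Proof.
move=> sAE; rewrite (reindex_onto (fun B => B :\: A) (fun D => A :|: D)) /=.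
  apply: eq_big => B; rewrite !inE.
    apply/andP/andP=> [[sBE /eqP<-]|[sBE sAB]].
      by rewrite subsetUl subUset sAE (subset_trans sBE (subsetDl _ _)).
    by rewrite setSD // setDE setUIr setUCr setIT; split=> //;
      apply/eqP/setUidPr.
  by case/andP=> _ /eqP eqB; rewrite cardsD (setIidPr _) // -eqB subsetUl.
move=> D; rewrite inE subsetD => /andP[_ dDA].
rewrite setDUl setDv set0U; apply/setDidPl; exact: dDA.
Qed.

(** Moebius inversion on the Boolean lattice of subsets of [B]. *)
Definition alt_sum (phi : {set T} -> int) B : int :=
  \sum_(A in powerset B) (-1) ^+ (#|B| - #|A|) * phi A.

(** Subsets containing [b] keep their sign, the others change it. This is the recursion by which
    [table_alt] computes. *)
Lemma alt_sumU1 phi b B : b \notin B ->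
  alt_sum phi (b |: B) = alt_sum (fun A => phi (b |: A)) B - alt_sum phi B.
Proof.
move=> nbB; rewrite /alt_sum sum_powersetU1 // -sumrN cardsU1 nbB.
congr (_ + _); apply: eq_bigr => A; rewrite inE => sA.
  by rewrite cardsU1 (contraNN (subsetP sA b) nbB).
by rewrite subSn ?subset_leq_card // exprS mulN1r mulNr.
Qed.

Lemma alt_sum_cst c B : B != set0 -> alt_sum (fun=> c) B = 0.
Proof.
move=> B0; rewrite /alt_sum -mulr_suml.
rewrite (eq_bigr (fun A : {set T} => 1 ^+ #|A| * (-1) ^+ (#|B| - #|A|))).
  by rewrite sum_powerset_expr subrr expr0n cards_eq0 (negPf B0) mul0r.
by move=> A _; rewrite expr1n mul1r.
Qed.

End SubsetSums.

(** * Rank, covered vertices and pendant edges *)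

Section Rank.
Variable G : sgraph.
Implicit Types (s : seq (G * G)) (u v x y z : G) (A B : {set {set G}}).

Lemma edgesP (b : {set G}) :
  reflect (exists x y, adj x y /\ b = [set x; y]) (b \in edges G).
Proof.
apply: (iffP imset2P) => [[x y _]|[x [y [xy ->]]]].
  by rewrite !inE => /= xy ->; exists x, y.
by exists x y; rewrite ?inE.
Qed.

Lemma mem_edges x y : ([set x; y] \in edges G) = adj x y.
Proof.
apply/edgesP/idP=> [[x' [y' [xy /setP eq_b]]]|]; last by exists x, y.
have ne : x' != y' by apply: contraTneq xy => ->; rewrite adj_irr.
have := eq_b x'; have := eq_b y'; rewrite !inE !eqxx orbT.
move=> /orP[]/eqP ey /orP[]/eqP ex; subst x' y'; rewrite ?eqxx // in ne *.
by rewrite adj_sym.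
Qed.

(** Ordering the edges and the ends of each edge lets statements about rank be proved by induction
    on lists. *)
Lemma edge_set_exists A : A \subset edges G ->
  exists2 s, edge_set s = A & size s = #|A|.
Proof.
move=> /subsetP sAE; rewrite cardE.
have: {subset enum A <= edges G} by move=> b; rewrite mem_enum; apply: sAE.
suff h l : {subset l <= edges G} ->
    exists2 s, edge_set s = [set b in l] & size s = size l.
  by case/h=> s es ss; exists s; rewrite ?es ?ss -?cardE //;
    apply/setP=> b; rewrite inE mem_enum.
elim: l => [_|b l IHl sl].
  by exists [::]; rewrite // edge_set_nil; apply/setP=> b; rewrite !inE.
have [b' b'l|s es ss] := IHl; first by apply: sl; rewrite inE b'l orbT.
have /edgesP[x [y [_ eb]]] := sl b (mem_head _ _).
exists ((x, y) :: s); last by rewrite /= ss.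
by rewrite edge_set_cons es -eb; apply/setP=> b'; rewrite !inE.
Qed.

Lemma label_rank_size s : (label_rank s <= size s)%N.
Proof. by elim: s => //= e s IHs; rewrite -addn1 leq_add // leq_b1. Qed.

Lemma rk_leq_card A : A \subset edges G -> (rk A <= #|A|)%N.
Proof.
by case/edge_set_exists=> s <- <-; rewrite rk_edge_set label_rank_size.
Qed.

Lemma edge_set_cat s s' : edge_set (s ++ s') = edge_set s :|: edge_set s'.
Proof.
elim: s => [|e s IHs]; first by rewrite edge_set_nil set0U.
by rewrite cat_cons !edge_set_cons IHs setUA.
Qed.

(** A list for [B] placed in front of a list for [A] represents [B] again, and [label_rank] never
    decreases when edges are put in front. *)
Lemma rkS A B : A \subset B -> B \subset edges G -> (rk A <= rk B)%N.
Proof.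
move=> sAB sBE.
have [s eA _] := edge_set_exists (subset_trans sAB sBE).
have [s' eB _] := edge_set_exists sBE.
rewrite -(setUidPl sAB) -eA -eB -edge_set_cat !rk_edge_set.
by elim: s' {eB} => //= e s' IH; apply: leq_trans IH (leq_addr _ _).
Qed.

Lemma cover_edge_set_cons (e : G * G) s :
  cover (edge_set (e :: s)) = [set e.1; e.2] :|: cover (edge_set s).
Proof. by rewrite edge_set_cons /cover bigcup_setU big_set1. Qed.

Lemma label_untouched s v : v \notin cover (edge_set s) ->
  label s v = v /\ forall z, label s z = v -> z = v.
Proof.
elim: s => // e s IHs; rewrite cover_edge_set_cons !inE !negb_or.
case/andP=> /andP[v1 v2] /IHs[lv lz] /=; rewrite lv.
have ne1 : v == label s e.1 = false.
  by apply: contra_neqF v1 => /eqP/esym/lz.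
rewrite ne1; split=> // z; case: eqP => [_ /lz ev|_ /lz//].
by rewrite ev eqxx in v2.
Qed.

Lemma label_rank_pendant s u v : u != v -> v \notin cover (edge_set s) ->
  label s u != label s v.
Proof.
move=> uv /label_untouched[-> lz]; apply: contra uv => /eqP/lz ->; exact: eqxx.
Qed.

Lemma rk_pendant A u v : A \subset edges G -> u != v -> v \notin cover A ->
  rk ([set u; v] |: A) = (rk A).+1.
Proof.
case/edge_set_exists=> s <- _ uv vs.
rewrite -(edge_set_cons (u, v)) !rk_edge_set /= label_rank_pendant //.
by rewrite addn1.
Qed.

(** An edge that does not raise the rank has both ends covered already, because an uncovered end
    would be a component of its own; any other edge covers at most two new vertices. *)
Lemma card_cover_rk A : A \subset edges G -> (#|cover A| <= (rk A).*2)%N.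
Proof.
move=> sAE; have [s eA _] := edge_set_exists sAE.
rewrite -eA rk_edge_set; have : edge_set s \subset edges G by rewrite eA.
elim: s {eA} => [_|e s IHs].
  by rewrite edge_set_nil /cover big_set0 cards0.
rewrite edge_set_cons subUset sub1set mem_edges => /andP[adj_e /IHs{}IHs].
rewrite -edge_set_cons cover_edge_set_cons /=.
have ne : e.1 != e.2 by apply: contraTneq adj_e => ->; rewrite adj_irr.
have [|] := eqVneq (label s e.1) (label s e.2);
  rewrite /= ?addn0 ?addn1.
  move=> eq_l; suff /setUidPr-> : [set e.1; e.2] \subset cover (edge_set s)
    by [].
  rewrite subUset !sub1set; apply/andP; split.
    by apply: contra_eqT eq_l => /label_rank_pendant h;
      rewrite eq_sym h // eq_sym.
  by apply: contra_eqT eq_l => /label_rank_pendant h; rewrite h.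
move=> _; apply: leq_trans (leq_of_leqif (leq_card_setU _ _)) _.
by rewrite cards2 ne doubleS !addSn add0n !ltnS.
Qed.

(* Up to sign, Crapo's beta invariant of the cycle matroid of [B]. *)
Definition rank_alt_sum B : int := alt_sum (fun A => (rk A)%:Z) B.

Definition pendant (B : {set {set G}}) : bool :=
  [exists b in B, exists v in b, forall b' in B, (v \in b') ==> (b' == b)].

(** The edge at a vertex of degree 1 is a coloop: without it the vertex is isolated, so adding it to
    any subset of the other edges joins two components. *)
Lemma pendant_rk B : B \subset edges G -> pendant B ->
  exists2 b, b \in B &
    forall A, A \subset B :\ b -> rk (b |: A) = (rk A).+1.
Proof.
move=> sBE /exists_inP[b bB /exists_inP[v vb /forall_inP vB]]; exists b => //.
have [u uv eb] : exists2 u, u != v & b = [set u; v].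
  have /edgesP[x [y [xy eb]]] := subsetP sBE b bB.
  have ne : x != y by apply: contraTneq xy => ->; rewrite adj_irr.
  move: vb; rewrite eb !inE => /orP[]/eqP ->; last by exists x.
  by exists y; rewrite 1?setUC // eq_sym.
move=> A sA; have sAB : A \subset B by apply: subset_trans sA (subsetDl _ _).
rewrite eb rk_pendant ?(subset_trans sAB) //; apply/bigcupP=> -[b' b'A vb'].
have := vB b' (subsetP sAB _ b'A); rewrite vb' => /eqP eb'.
by have := subsetP sA _ b'A; rewrite eb' !inE eqxx.
Qed.

(** With a coloop [b], the two sums in [alt_sumU1] differ by the alternating sum of the constant 1
    over [B :\ b]. It vanishes because a second edge keeps [B :\ b] nonempty; a single edge has
    value 1. *)
Lemma rank_alt_sum_pendant B : B \subset edges G -> (1 < #|B|)%N ->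
  pendant B -> rank_alt_sum B = 0.
Proof.
move=> sBE gt1B /(pendant_rk sBE)[b bB rkb].
have nb : b \notin B :\ b by rewrite !inE eqxx.
rewrite -(setD1K bB) /rank_alt_sum alt_sumU1 //.
rewrite -[X in X - _](_ : alt_sum (fun A => (rk A)%:Z + 1) (B :\ b) = _).
  rewrite /alt_sum -sumrB.
  under eq_bigr do rewrite -mulrBr addrAC subrr add0r.
  apply: alt_sum_cst; rewrite -card_gt0.
  by rewrite (cardsD1 b) bB in gt1B.
by apply: eq_bigr => A; rewrite inE => /rkb ->; rewrite -addn1 PoszD.
Qed.

End Rank.

(** * The polynomial integrand *)

Section Integrand.
Variables (R : realFieldType) (G : sgraph).
Local Notation E := (edges G).
Local Notation r := (rk E).

(** At t this is the expectation of r(G) - r(A) when A contains each edge independently with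
    probability t. *)
Definition rank_poly : {poly R} :=
  \sum_(A in powerset E)
    (r - rk A)%:R *: ('X^#|A| * (1 - 'X) ^+ (#|E| - #|A|)).

Lemma horner_tutte (x y : R) :
  (tutte R G).[x, y] =
    \sum_(A in powerset E) (x - 1) ^+ (r - rk A) * (y - 1) ^+ (#|A| - rk A).
Proof.
by rewrite /tutte !horner_sum; apply: eq_bigr => A _; rewrite !hornerE.
Qed.

Lemma horner_deriv_tutte (x y : R) :
  (tutte R G)^`().[x, y] =
    \sum_(A in powerset E)
      (x - 1) ^+ (r - rk A).-1 *+ (r - rk A) * (y - 1) ^+ (#|A| - rk A).
Proof.
rewrite /tutte raddf_sum /= !horner_sum; apply: eq_bigr => A _.
rewrite derivM deriv_exp.
have -> : (('Y - 1) ^+ (#|A| - rk A))^`() = 0 :> {poly {poly R}}.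
  by rewrite -[1]/(1%:P%:P) -polyCB -polyC_exp derivC.
rewrite mulr0 addr0 derivB derivX -[1 in X in _ - X^`()]/(1%:P) derivC.
rewrite subr0 mul1r.
by rewrite !hornerE !hornerMn !hornerE.
Qed.

(** With u = x - 1 and w = y - 1 one has u w = 1 and w (1 - t) = t. After multiplication by (1 -
    t)^m, each term of T is thus u^r(G) times the binomial weight of A. The weights sum to 1, and u
    T_x gives the same terms weighted by the corank, so the common factor u^r(G) cancels. *)
Lemma steele_integrandE (t : R) : 0 < t < 1 ->
  steele_integrand G t = rank_poly.[t].
Proof.
case/andP=> t_gt0 t_lt1; pose u := t^-1 - 1; pose w := (1 - t)^-1 - 1.
have t0 : t != 0 by rewrite gt_eqF.
have t1 : 1 - t != 0 by rewrite subr_eq0 gt_eqF.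
have u0 : u != 0.
  have -> : u = (1 - t) / t by rewrite /u; field.
  by rewrite mulf_neq0 ?invr_eq0.
have uw : u * w = 1 by rewrite /u /w; field; rewrite t0 t1.
have wt : w * (1 - t) = t by rewrite /w; field.
have wE A : A \in powerset E -> w ^+ (#|A| - rk A) = u ^+ rk A * w ^+ #|A|.
  rewrite inE => /rk_leq_card leA.
  by rewrite -{2}(subnKC leA) exprD mulrA -exprMn uw expr1n mul1r.
have wtE A : A \in powerset E ->
    w ^+ #|A| * (1 - t) ^+ #|E| = t ^+ #|A| * (1 - t) ^+ (#|E| - #|A|).
  rewrite inE => /subset_leq_card leA.
  by rewrite -{1}(subnKC leA) exprD mulrA -exprMn wt.
have eT : (tutte R G).[t^-1, (1 - t)^-1] * (1 - t) ^+ #|E| = u ^+ r.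
  rewrite horner_tutte -/u -/w mulr_suml.
  transitivity (\sum_(A in powerset E)
      u ^+ r * (t ^+ #|A| * (1 - t) ^+ (#|E| - #|A|))).
    apply: eq_bigr => A sA; rewrite wE // -wtE //.
    have leA : (rk A <= r)%N by apply: rkS => //; rewrite inE in sA.
    by rewrite !mulrA -exprD subnK.
  by rewrite -mulr_sumr sum_powerset_expr addrC subrK expr1n mulr1.
have eD : u * (tutte R G)^`().[t^-1, (1 - t)^-1] * (1 - t) ^+ #|E|
    = u ^+ r * rank_poly.[t].
  rewrite horner_deriv_tutte -/u -/w mulr_sumr mulr_suml horner_sum mulr_sumr.
  have e1t : (1 - 'X : {poly R}).[t] = 1 - t by rewrite !hornerE.
  apply: eq_bigr => A sA; rewrite wE // hornerZ hornerM hornerXn horner_exp e1t.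
  rewrite -wtE //.
  have leA : (rk A <= r)%N by apply: rkS => //; rewrite inE in sA.
  (* For corank 0 both sides vanish; otherwise the extra factor u restores the exponent lowered by
     differentiation. *)
  case: (r - rk A)%N (subnK leA) => [|d] <- /=.
    by rewrite !mulr0n !(mul0r, mulr0).
  rewrite -mulr_natl exprD exprS.
  move: (u ^+ d) (u ^+ rk A) (w ^+ _) ((1 - t) ^+ _) (d.+1%:R) => a b c a' b'.
  ring.
rewrite /steele_integrand.
have -> : (1 - t) / t = u by rewrite /u; field.
have T0 : (tutte R G).[t^-1, (1 - t)^-1] != 0.
  by apply: contraTneq (expf_neq0 r u0) => T0; rewrite -eT T0 mul0r eqxx.
apply: (mulfI (expf_neq0 r u0)); rewrite -eD -{1}eT.
move: (tutte R G).[_, _] T0 ((tutte R G)^`()).[_, _] ((1 - t) ^+ _) => T T0 D c.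
by field.
Qed.

Lemma rank_polyP : is_polynomial_integrand G rank_poly.
Proof.
split=> [|t t01]; last by rewrite steele_integrandE.
apply: leq_trans (size_sum _ _ _) _; apply/bigmax_leqP => A.
rewrite inE => /subset_leq_card leA; apply: leq_trans (size_scale_leq _ _) _.
rewrite mulrC; apply: leq_trans (size_polyMleq _ _) _.
rewrite size_polyXn addnS /=.
have := size_poly_exp_leq (1 - 'X : {poly R}) (#|E| - #|A|).
rewrite -opprB size_polyN size_XsubC mul1n => le.
by rewrite (leq_trans (leq_add le (leqnn _))) // addSn subnK.
Qed.

Lemma polynomial_integrandE : polynomial_integrand R G = rank_poly.
Proof.
rewrite /polynomial_integrand.
have [_ pP] : is_polynomial_integrand G
    (classical_sets.xget 0 (fun p : {poly R} => is_polynomial_integrand G p)).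
  by apply: classical_sets.xgetPex; exists rank_poly; apply: rank_polyP.
set p := classical_sets.xget _ _ in pP *.
apply/eqP; rewrite -subr_eq0; apply/negPn/negP => nz.
(* As many distinct roots as the size of the difference are too many; the points 1/(k+2) all lie in
   the open interval where both polynomials are known to agree. *)
pose rs := [seq (k.+2%:R^-1 : R) | k <- iota 0 (size (p - rank_poly))].
have := max_poly_roots (rs := rs) nz; rewrite size_map size_iota ltnn.
suff [-> ->] : all (root (p - rank_poly)) rs /\ uniq rs by move/(_ isT isT).
split.
  apply/allP=> t /mapP[k _ ->]; rewrite rootE hornerD hornerN subr_eq0.
  have t01 : 0 < (k.+2%:R^-1 : R) < 1.
    by rewrite invr_gt0 ltr0n invf_lt1 ?ltr0n // ltr1n.
  by rewrite pP // steele_integrandE.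
rewrite map_inj_uniq ?iota_uniq // => k l /invr_inj/eqP.
by rewrite eqr_nat !eqSS => /eqP.
Qed.

(** Expanding (1 - t)^(m - |A|) over the edge sets D disjoint from A and setting B = A + D, the term
    of B has degree |B|. The positivity of i discards the constant term of [p + 1] and makes B
    nonempty. *)
Lemma mst_coefE i : (0 < i)%N ->
  mst_coef R G i =
    (\sum_(B in powerset E | #|B| == i) - rank_alt_sum B)%:~R.
Proof.
move=> i_gt0.
rewrite /mst_coef polynomial_integrandE coefD coef1 eqn0Ngt i_gt0 addr0.
pose F (A B : {set {set G}}) : R := (r - rk A)%:R * (-1) ^+ (#|B| - #|A|).
transitivity (\sum_(A in powerset E)
    \sum_(B in powerset E | (A \subset B) && (#|B| == i)) F A B).
  rewrite /rank_poly coef_sum; apply: eq_bigr => A; rewrite inE => sAE.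
  rewrite coefZ -mulr_sumr; congr (_ * _).
  have -> : #|E| = (#|E :\: A| + #|A|)%N.
    by rewrite cardsD (setIidPr sAE) subnK ?subset_leq_card.
  rewrite addnK [1 - 'X]addrC -sum_powerset_expr.
  under eq_bigr do rewrite expr1n mulr1.
  rewrite (sum_supersets (fun d => (- 'X) ^+ d) sAE) mulr_sumr coef_sum.
  rewrite big_mkcondr /= [RHS]big_mkcondr; apply: eq_bigr => B _.
  have [sAB|//] := boolP (A \subset B).
  rewrite [(- 'X) ^+ _]exprNn mulrCA -exprD subnKC ?subset_leq_card //.
  rewrite -polyC1 -polyCN -polyC_exp mul_polyC coefZ coefXn eq_sym.
  by case: eqP; rewrite ?mulr1 ?mulr0.
rewrite (exchange_big_dep (fun B => (B \in powerset E) && (#|B| == i))) /=;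
    last first.
  by move=> A B _ /andP[-> /andP[_ ->]].
rewrite rmorph_sum; apply: eq_bigr => B /andP[]; rewrite inE => sBE /eqP cB.
transitivity (\sum_(A in powerset B) F A B).
  apply: eq_bigl => A; rewrite !inE sBE cB eqxx andbT /=.
  by rewrite andb_idl // => sAB; apply: subset_trans sAB sBE.
rewrite /rank_alt_sum.
(* The constant r(G) has alternating sum 0 over the subsets of the nonempty set B. *)
have <- : alt_sum (fun A => (r : int) - (rk A)%:Z) B
    = - alt_sum (fun A => (rk A)%:Z) B.
  rewrite -sub0r -[X in X - _](alt_sum_cst (r : int) (B := B)).
    by rewrite /alt_sum -sumrB; apply: eq_bigr => A _; rewrite mulrBr.
  by rewrite -card_gt0 cB.
rewrite rmorph_sum; apply: eq_bigr => A; rewrite inE => sAB.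
by rewrite /F subzn ?rkS ?(subset_trans sAB) //= intrM rmorphXn rmorphN1 mulrC.
Qed.

End Integrand.

(** * Relabelled edge sets *)

Fixpoint combs (T : Type) (l : seq T) (n : nat) : seq (seq T) :=
  match n, l with
  | 0, _ => [:: [::]]
  | _.+1, [::] => [::]
  | n'.+1, x :: l' => [seq x :: s | s <- combs l' n'] ++ combs l' n
  end.

Lemma mem_combs (T : eqType) (s l : seq T) :
  subseq s l -> s \in combs l (size s).
Proof.
elim: l s => [|x l IHl] [|y s] //=; rewrite mem_cat.
case: eqP => [-> /IHl sl|_ /IHl-> //]; last by rewrite orbT.
by rewrite map_f.
Qed.

Definition pairs (k : nat) : seq (nat * nat) :=
  [seq (i, j) | j <- iota 0 k, i <- iota 0 j].

Lemma mem_pairs k i j : ((i, j) \in pairs k) = (i < j < k)%N.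
Proof.
apply/allpairsPdep/idP => [[j' [i' []]]|/andP[ij jk]].
  by rewrite !mem_iota => /= jk ij [-> ->]; rewrite ij jk.
by exists j, i; rewrite !mem_iota.
Qed.

Lemma pairs_uniq k : uniq (pairs k).
Proof.
apply: allpairs_uniq_dep => [|j _|]; rewrite ?iota_uniq //.
by move=> [j i] [j' i'] _ _ /= [-> ->].
Qed.

Definition linked (ps : seq (nat * nat)) (i j : nat) : bool :=
  ((i, j) \in ps) || ((j, i) \in ps).

Definition touches (i : nat) (e : nat * nat) : bool := (e.1 == i) || (e.2 == i).

Definition min_degree2 (k : nat) (ps : seq (nat * nat)) : bool :=
  all (fun i => 1 < count (touches i) ps)%N (iota 0 k).

(** The handshake count: the degrees sum to at least 2k, while each edge touches at most two
    indices. This bounds the number of vertices to be enumerated. *)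
Lemma min_degree2_size k ps : min_degree2 k ps -> (k <= size ps)%N.
Proof.
move=> /allP deg; rewrite -leq_double.
have le1 : (k.*2 <= \sum_(i <- iota 0 k) count (touches i) ps)%N.
  rewrite -[k in (k.*2)%N](size_iota 0) -muln2 -sum1_size big_distrl /=.
  by rewrite big_seq [leqRHS]big_seq leq_sum // => i /deg.
apply: leq_trans le1 _; under eq_bigr do rewrite -sum1_count big_mkcond.
rewrite exchange_big -muln2 -sum1_size big_distrl /=; apply: leq_sum => e _.
rewrite -big_mkcond sum1_count.
apply: (@leq_trans (count (pred1 e.1) (iota 0 k)
                    + count (pred1 e.2) (iota 0 k))).
  rewrite -count_predUI; apply: leq_trans (leq_addr _ _).
  by apply: sub_count => i /=; rewrite /touches ![i == _]eq_sym.
by rewrite (@leq_add _ _ 1 1) // count_uniq_mem ?iota_uniq // leq_b1.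
Qed.

(* Computable counterpart of [label]: entry i of [tbl] is the index of the label
   of vertex i. *)
Definition merge_labels (tbl : seq nat) (e : nat * nat) : seq nat :=
  let a := nth 0 tbl e.1 in let b := nth 0 tbl e.2 in
  [seq if c == a then b else c | c <- tbl].

Definition separated (tbl : seq nat) (e : nat * nat) : bool :=
  nth 0 tbl e.1 != nth 0 tbl e.2.

Fixpoint table_rank (tbl : seq nat) (r : nat) (ps : seq (nat * nat)) : nat :=
  if ps is e :: ps' then
    table_rank (merge_labels tbl e) (r + separated tbl e) ps'
  else r.

(** [tbl] and [r] describe the edges kept so far, and each leaf is the rank of one subset; subsets
    with the same initial choices share the tables built for them. *)
Fixpoint table_alt (tbl : seq nat) (r : nat) (ps : seq (nat * nat)) : int :=
  if ps is e :: ps' then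
    table_alt (merge_labels tbl e) (r + separated tbl e) ps'
    - table_alt tbl r ps'
  else r%:Z.

Section Tables.
Variables (G : sgraph) (x0 : G) (vs : seq G).
Hypothesis vs_uniq : uniq vs.
Local Notation phi := (nth x0 vs).
Local Notation phi2 e := (phi e.1, phi e.2).
Local Notation k := (size vs).
Implicit Types (s : seq (G * G)) (tbl : seq nat) (ps : seq (nat * nat)).

Definition table_of s tbl :=
  [/\ size tbl = k, {in tbl, forall c, c < k}%N
    & forall i, (i < k)%N -> label s (phi i) = phi (nth 0 tbl i)].

Lemma table_of_nil : table_of [::] (iota 0 k).
Proof.
split=> [|c|i ik]; first by rewrite size_iota.
  by rewrite mem_iota.
by rewrite nth_iota.
Qed.

Lemma nth_table_lt s tbl i : table_of s tbl -> (i < k)%N -> (nth 0 tbl i < k)%N.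
Proof. by case=> sz lt _ ik; apply/lt/mem_nth; rewrite sz. Qed.

Lemma separatedE s tbl e : table_of s tbl -> (e.1 < k)%N -> (e.2 < k)%N ->
  separated tbl e = (label s (phi e.1) != label s (phi e.2)).
Proof.
move=> st e1 e2; have [_ _ lab] := st.
by rewrite /separated !lab // [in RHS]nth_uniq ?(nth_table_lt st).
Qed.

Lemma table_of_cons s tbl e : table_of s tbl -> (e.1 < k)%N -> (e.2 < k)%N ->
  table_of (phi2 e :: s) (merge_labels tbl e).
Proof.
move=> st e1 e2; have [sz lt lab] := st; split=> [|c|i ik].
- by rewrite size_map.
- by case/mapP=> c' /lt c'k ->; case: ifP => // _; exact: (nth_table_lt st).
rewrite (nth_map 0) ?sz //= !lab // nth_uniq ?(nth_table_lt st) //.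
by case: ifP.
Qed.

Lemma table_rankE s tbl ps : table_of s tbl -> 
  all (fun e => (e.1 < k) && (e.2 < k))%N ps ->
  table_rank tbl (label_rank s) ps
    = rk (edge_set s :|: edge_set [seq phi2 e | e <- ps]).
Proof.
elim: ps s tbl => [|e ps IHps] s tbl st /=.
  by rewrite edge_set_nil setU0 rk_edge_set.
case/andP=> /andP[e1 e2] psk; rewrite (separatedE st) //.
rewrite -[(_ + _)%N]/(label_rank (phi2 e :: s)) IHps //;
  last exact: table_of_cons.
by rewrite !edge_set_cons setUCA setUA.
Qed.

(** The prefix [s] of edges already kept is arbitrary, so that the induction can move the head of
    [ps] into it. Distinctness of the edges gives the side condition of [alt_sumU1]. *)
Lemma table_altE s tbl ps : table_of s tbl -> 
  all (fun e => (e.1 < k) && (e.2 < k))%N ps ->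
  uniq [seq [set phi e.1; phi e.2] | e <- ps] ->
  table_alt tbl (label_rank s) ps
    = alt_sum (fun A => (rk (edge_set s :|: A))%:Z)
              (edge_set [seq phi2 e | e <- ps]).
Proof.
elim: ps s tbl => [|e ps IHps] s tbl st /=.
  rewrite edge_set_nil /alt_sum powerset0 big_set1 cards0 mul1r setU0.
  by rewrite rk_edge_set.
case/andP=> /andP[e1 e2] psk /andP[ne psu]; rewrite (separatedE st) //.
rewrite -[(_ + _)%N]/(label_rank (phi2 e :: s)) !IHps //;
  last exact: table_of_cons.
rewrite [in RHS]edge_set_cons alt_sumU1.
  congr (_ - _); apply: eq_bigr => A _.
  by rewrite edge_set_cons /= setUCA setUA.
apply: contra ne => /imsetP[_ /mapP[e' e'ps ->] /= ->].
by apply/mapP; exists e'.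
Qed.

Variable B : {set {set G}}.
Hypothesis BE : B \subset edges G.
Hypothesis Bvs : {subset cover B <= vs}.

(** Filtering the fixed list [pairs k] yields each edge once and in a fixed order, so the result
    occurs literally among [combs (pairs k) #|B|]. *)
Definition index_pairs : seq (nat * nat) :=
  [seq e <- pairs k | [set phi e.1; phi e.2] \in B].
Local Notation ps := index_pairs.

Lemma index_pairs_lt e : e \in ps -> (e.1 < e.2 < k)%N.
Proof. by case: e => i j; rewrite mem_filter mem_pairs => /andP[]. Qed.

Lemma all_index_pairs : all (fun e => (e.1 < k) && (e.2 < k))%N ps.
Proof.
apply/allP=> e /index_pairs_lt /andP[ij jk].
by rewrite jk (ltn_trans ij).
Qed.

Lemma mem_vs b v : b \in B -> v \in b -> v \in vs.
Proof. by move=> bB vb; apply: Bvs; apply/bigcupP; exists b. Qed.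

Lemma linked_index_pairs i j : (i < k)%N -> (j < k)%N ->
  linked ps i j = ([set phi i; phi j] \in B).
Proof.
move=> ik jk; rewrite /linked !mem_filter !mem_pairs /= ik jk !andbT.
rewrite [[set phi j; _]]setUC -andb_orr.
case: ltngtP => [_|_|->]; rewrite ?andbT ?andbF //.
apply/esym/negbTE/negP => /(subsetP BE).
by rewrite mem_edges adj_irr.
Qed.

Lemma index_pairs_inj :
  {in ps &, injective (fun e => [set phi e.1; phi e.2])}.
Proof.
move=> [i j] [i' j'] /index_pairs_lt/= /andP[ij jk].
move=> /index_pairs_lt/= /andP[ij' jk'].
have ik := ltn_trans ij jk; have ik' := ltn_trans ij' jk'.
move=> /setP eqs; have := eqs (phi i); have := eqs (phi j).
have := eqs (phi i'); rewrite !inE !eqxx !orbT !nth_uniq //.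
move=> ei' /esym ej /esym ei; congr (_, _); lia.
Qed.

Lemma uniq_index_edges : uniq [seq [set phi e.1; phi e.2] | e <- ps].
Proof.
by rewrite map_inj_in_uniq ?filter_uniq ?pairs_uniq //; apply: index_pairs_inj.
Qed.

Lemma mem_index_edges b :
  (b \in [seq [set phi e.1; phi e.2] | e <- ps]) = (b \in B).
Proof.
apply/mapP/idP=> [[e]|bB]; first by rewrite mem_filter => /andP[eB _] ->.
have /edgesP[x [y [_ eb]]] := subsetP BE b bB.
have xv : x \in vs by apply: mem_vs bB _; rewrite eb !inE eqxx.
have yv : y \in vs by apply: mem_vs bB _; rewrite eb !inE eqxx orbT.
have : linked ps (index x vs) (index y vs).
  by rewrite linked_index_pairs ?index_mem // !nth_index // -eb.
case/orP=> ein.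
  by exists (index x vs, index y vs); rewrite //= !nth_index.
by exists (index y vs, index x vs); rewrite //= !nth_index // setUC.
Qed.

Lemma edge_set_index_pairs : edge_set [seq phi2 e | e <- ps] = B.
Proof.
apply/setP=> b; rewrite -mem_index_edges.
apply/imsetP/mapP => [[_ /mapP[e eps ->] ->]|[e eps ->]]; first by exists e.
by exists (phi2 e) => //; apply: map_f.
Qed.

Lemma size_index_pairs : size ps = #|B|.
Proof.
rewrite -(size_map (fun e => [set phi e.1; phi e.2])).
rewrite -(card_uniqP uniq_index_edges).
exact: eq_card mem_index_edges.
Qed.

Lemma rk_index_pairs : table_rank (iota 0 k) 0 ps = rk B.
Proof.
(* The starting state is that of the empty list: rank 0, and every vertex is its own label. *)
rewrite -[0%N]/(label_rank ([::] : seq (G * G))).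
rewrite (table_rankE table_of_nil) ?all_index_pairs //.
by rewrite edge_set_nil set0U edge_set_index_pairs.
Qed.

Lemma rank_alt_sum_index_pairs : table_alt (iota 0 k) 0 ps = rank_alt_sum B.
Proof.
rewrite -[0%N]/(label_rank ([::] : seq (G * G))).
rewrite (table_altE table_of_nil) ?all_index_pairs ?uniq_index_edges //.
rewrite edge_set_index_pairs; apply: eq_bigr => A _.
by rewrite edge_set_nil set0U.
Qed.

Lemma index_pairs_combs : ps \in combs (pairs k) #|B|.
Proof. by rewrite -size_index_pairs mem_combs // filter_subseq. Qed.

Lemma index_pairs_min_degree2 :
  {subset vs <= cover B} -> ~~ pendant B -> min_degree2 k ps.
Proof.
move=> vsB npB; apply/allP=> i; rewrite mem_iota /= add0n => ik.
have /bigcupP[b bB vb] := vsB _ (mem_nth x0 ik).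
(* If [b] were the only edge at this vertex, [B] would be pendant. *)
have [b' b'B] : exists2 b', b' \in B & (phi i \in b') && (b' != b).
  apply/exists_inP; apply: contraNT npB.
  rewrite negb_exists_in => /forall_inP npB.
  apply/exists_inP; exists b => //; apply/exists_inP; exists (phi i) => //.
  by apply/forall_inP=> b' /npB; rewrite negb_and negbK implybE.
case/andP=> vb' ne; move: bB b'B; rewrite -!mem_index_edges.
case/mapP=> e eps eb /mapP[e' e'ps eb'].
rewrite -size_filter; apply: (@uniq_leq_size _ [:: e; e']).
  by rewrite /= inE andbT; apply: contraNneq ne => eq_e; rewrite eb eb' eq_e.
have aux f : f \in ps -> phi i \in [set phi f.1; phi f.2] ->
    f \in filter (touches i) ps.
  move=> fps; rewrite mem_filter fps andbT !inE.
  have /andP[f12 f2k] := index_pairs_lt fps.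
  by rewrite !nth_uniq // ?(ltn_trans f12) // /touches ![i == _]eq_sym.
by move=> f; rewrite !inE => /orP[]/eqP ->; apply: aux; rewrite -?eb -?eb'.
Qed.

End Tables.

(** * Counting subgraphs *)

(* Some copy of [H] in [G] uses only edges of [B] and meets all vertices of [B].
   Edges of [B] outside the copy are allowed: they are the chords in c_{5,1}. *)
Definition spans (H G : sgraph) (B : {set {set G}}) : bool :=
  [exists f : {ffun H -> G},
    [&& injectiveb f, [forall x, forall y, adj x y ==> ([set f x; f y] \in B)]
      & cover B \subset f @: [set: H]]].

(** Minimum degree at least two. It lets the vertex set of a copy be recovered as the cover of its
    edges, and it keeps spanned edge sets free of pendant edges. *)
Definition two_neighbours (H : sgraph) : Prop :=
  forall x : H, exists y z, [/\ y != z, adj x y & adj x z].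

Lemma spansP (H G : sgraph) (B : {set {set G}}) :
  reflect (exists f : {ffun H -> G},
    [/\ injective f, forall x y, adj x y -> [set f x; f y] \in B
      & cover B \subset f @: [set: H]]) (spans H B).
Proof.
apply: (iffP existsP) => -[f].
  case/and3P=> /injectiveP fi /forallP fa fc; exists f; split=> // x y.
  by apply/implyP; move/forallP: (fa x).
case=> fi fa fc; exists f; apply/and3P; split=> //; first exact/injectiveP.
by apply/forallP=> x; apply/forallP=> y; apply/implyP/fa.
Qed.

(** Every covered vertex lies in the copy and has two neighbours there. The indicators of spanning
    copies hence vanish on pendant sets, just as [rank_alt_sum] does. *)
Lemma spans_pendant (H G : sgraph) (B : {set {set G}}) :
  two_neighbours H -> spans H B -> ~~ pendant B.
Proof.
move=> H2 /spansP[f [fi fa fc]]; apply/negP.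
case/exists_inP=> b bB /exists_inP[v vb].
move/forall_inP => eqb.
have /imsetP[x _ ev] : v \in f @: [set: H].
  by apply: (subsetP fc); apply/bigcupP; exists b.
have [y [z [yz xy xz]]] := H2 x.
have ey : [set f x; f y] = b.
  by apply/eqP; have := eqb _ (fa _ _ xy); rewrite ev !inE eqxx; apply.
have ez : [set f x; f z] = b.
  by apply/eqP; have := eqb _ (fa _ _ xz); rewrite ev !inE eqxx; apply.
have : f z \in [set f x; f y] by rewrite ey -ez !inE eqxx orbT.
have nzx : z != x by apply: contraTneq xz => ->; rewrite adj_irr.
by rewrite !inE !(inj_eq fi) (negPf nzx) eq_sym (negPf yz).
Qed.

Lemma cover_spans (H G : sgraph) (B : {set {set G}}) (f : {ffun H -> G}) :
  two_neighbours H -> (forall x y, adj x y -> [set f x; f y] \in B) ->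
  f @: [set: H] \subset cover B.
Proof.
move=> H2 fa; apply/subsetP=> _ /imsetP[x _ ->].
have [y [_ [_ /fa xy _]]] := H2 x.
by apply/bigcupP; exists [set f x; f y] => //; rewrite !inE eqxx.
Qed.

Lemma imset_pair (T U : finType) (f : T -> U) x y :
  f @: [set x; y] = [set f x; f y].
Proof. by rewrite imsetU !imset_set1. Qed.

Definition edge_image (H G : sgraph) (f : {ffun H -> G}) : {set {set G}} :=
  [set f @: (a : {set H}) | a in edges H].

Lemma mem_edge_image (H G : sgraph) (f : {ffun H -> G}) x y :
  adj x y -> [set f x; f y] \in edge_image f.
Proof.
by move=> xy; rewrite -imset_pair; apply: imset_f; rewrite mem_edges.
Qed.

Lemma edge_image_sub (H G : sgraph) (f : {ffun H -> G}) (B : {set {set G}}) :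
  (forall x y, adj x y -> [set f x; f y] \in B) -> edge_image f \subset B.
Proof.
move=> fa; apply/subsetP=> _ /imsetP[_ /edgesP[x [y [xy ->]]] ->].
by rewrite imset_pair fa.
Qed.

Lemma card_edge_image (H G : sgraph) (f : {ffun H -> G}) :
  injective f -> #|edge_image f| = #|edges H|.
Proof. by move=> fi; rewrite card_imset //; apply: imset_inj. Qed.

Lemma cover_edge_image (H G : sgraph) (f : {ffun H -> G}) :
  two_neighbours H -> cover (edge_image f) = f @: [set: H].
Proof.
move=> H2; apply/eqP; rewrite eqEsubset cover_spans // ?andbT => [|x y];
  last first.
  exact: mem_edge_image.
by apply/bigcupsP=> _ /imsetP[a _ ->]; apply: imsetS; apply: subsetT.
Qed.

Lemma copiesP (H G : sgraph) (S : {set G} * {set {set G}}) :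
  two_neighbours H ->
  reflect (exists f : {ffun H -> G},
    [/\ injective f, edge_image f \subset edges G
      & S = (f @: [set: H], edge_image f)])
    (S \in copies H G).
Proof.
move=> H2; rewrite inE /is_subgraph /sub_iso; apply: (iffP andP).
  case=> /andP[SE _] /existsP[f /and3P[/injectiveP fi /eqP S1 /eqP S2]].
  by exists f; rewrite /edge_image -S1 -S2 -surjective_pairing.
case=> f [fi fE ->]; split=> /=.
  rewrite fE; apply/forall_inP=> _ /imsetP[a _ ->].
  exact/imsetS/subsetT.
by apply/existsP; exists f; apply/and3P; split=> //; apply/injectiveP.
Qed.

(** A copy has no isolated vertex, so B -> (cover B, B) matches edge sets with copies; equality of
    the edge numbers forces B to be the image of the edges of [H]. *)
Lemma num_copies (H G : sgraph) : two_neighbours H ->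
  #|copies H G| =
    #|[set B in powerset (edges G) | (#|B| == #|edges H|) && spans H B]|.
Proof.
move=> H2; rewrite -[RHS](card_imset _ (f := fun B => (cover B, B)));
  last first.
  by move=> B B' [].
apply: eq_card => S; apply/copiesP/imsetP => // [[f [fi fE ->]]|[B]].
  exists (edge_image f); last by rewrite cover_edge_image.
  rewrite !inE fE card_edge_image // eqxx; apply/spansP; exists f; split=> //.
    exact: mem_edge_image.
  by rewrite cover_edge_image.
rewrite !inE => /and3P[BE /eqP cB /spansP[f [fi fa fc]] ->].
have eB : edge_image f = B.
  apply/eqP; rewrite eqEcard edge_image_sub //=.
  by rewrite card_edge_image // cB.
by exists f; rewrite -cover_edge_image // eB.
Qed.

(** The extra edge of B is the chord. Copy and chord are existentially quantified on the left, as
    the injection is in [spans], so each resulting subgraph is counted once. *)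
Lemma num_chorded_copies (H G : sgraph) : two_neighbours H ->
  #|[set S : {set G} * {set {set G}} |
      [exists C in copies H G, exists a in edges G :\: C.2,
        (a \subset C.1) && (S == (C.1, a |: C.2))]]| =
    #|[set B in powerset (edges G) | (#|B| == #|edges H|.+1) && spans H B]|.
Proof.
move=> H2; rewrite -[RHS](card_imset _ (f := fun B => (cover B, B)));
  last first.
  by move=> B B' [].
apply: eq_card => S; rewrite inE; apply/exists_inP/imsetP => [[C]|[B]].
  case/copiesP=> // f [fi fE ->] /exists_inP[a /=]; rewrite inE => /andP[na aE].
  case/andP=> af /eqP->; exists (a |: edge_image f); last first.
    rewrite /cover bigcup_setU big_set1 -/(cover _) cover_edge_image //.
    by rewrite (setUidPr af).
  rewrite !inE subUset sub1set aE fE cardsU1 na card_edge_image // eqxx.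
  apply/spansP; exists f; split=> // [x y /(mem_edge_image f) xy|].
    by rewrite inE xy orbT.
  rewrite /cover bigcup_setU big_set1 -/(cover _) cover_edge_image //.
  by rewrite (setUidPr af).
rewrite !inE => /and3P[BE /eqP cB /spansP[f [fi fa fc]] ->].
have fB := edge_image_sub fa.
(* B has exactly one edge more than the copy inside it. *)
have [a ea] : exists a, B :\: edge_image f = [set a].
  apply/cards1P; rewrite cardsD (setIidPr fB) cB card_edge_image //.
  by rewrite subSn // subnn.
have /setDP[aB na] : a \in B :\: edge_image f by rewrite ea set11.
have eB : a |: edge_image f = B.
  by rewrite -ea setUC setDE setUIr setUCr setIT; apply/setUidPr.
have cvB : cover B = f @: [set: H].
  by apply/eqP; rewrite eqEsubset fc cover_spans.
exists (f @: [set: H], edge_image f).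
  by apply/copiesP=> //; exists f; split=> //; apply: subset_trans fB BE.
apply/exists_inP; exists a; rewrite ?inE /= ?na ?(subsetP BE) //.
rewrite eB cvB eqxx andbT.
by rewrite -cvB; apply/subsetP=> v va; apply/bigcupP; exists a.
Qed.

(** The word [w] sends the i-th vertex of the pattern to the vertex of index [nth 0 w i]. The
    conditional keeps eager evaluation from listing permutations when the vertex numbers differ. *)
Definition spans_pairs (hs : seq (nat * nat)) (q k : nat)
    (ps : seq (nat * nat)) : bool :=
  if q == k then
    has (fun w => all (fun e => linked ps (nth 0 w e.1) (nth 0 w e.2)) hs)
      (permutations (iota 0 k))
  else false.

(* [us] enumerates [H] so that [hs] lists its edges as pairs of indices. *)
Definition presents (H : sgraph) (hs : seq (nat * nat)) (us : seq H) : Prop :=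
  [/\ uniq us, forall x, x \in us,
      all (fun e => (e.1 < size us) && (e.2 < size us))%N hs
    & forall x y, adj x y = linked hs (index x us) (index y us)].

Section Presentation.
Variables (H : sgraph) (hs : seq (nat * nat)) (us : seq H) (y0 : H).
Hypotheses (Hus : presents hs us) (H2 : two_neighbours H).

(** The pattern [H] is itself treated as an edge set relabelled by [us], which makes its number of
    edges computable. *)
Lemma card_edges_pairs :
  #|edges H| = count (fun e => linked hs e.1 e.2) (pairs (size us)).
Proof.
have [us_uniq us_full hs_lt adjE] := Hus.
rewrite -(size_index_pairs y0 us_uniq) // /index_pairs size_filter.
apply: eq_in_count => -[i j]; rewrite mem_pairs => /andP[ij jk] /=.
by rewrite mem_edges adjE !index_uniq // (ltn_trans ij).
Qed.

Variables (G : sgraph) (x0 : G) (B : {set {set G}}).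
Hypothesis BE : B \subset edges G.
Local Notation vs := (enum (cover B)).
Local Notation phi := (nth x0 vs).

(** The image of a spanning copy is exactly [cover B], so reading the injection through the two
    enumerations gives a permutation of the indices, and conversely. *)
Lemma spansE :
  spans H B = spans_pairs hs (size us) (size vs) (index_pairs x0 vs B).
Proof.
have [us_uniq us_full hs_lt adjE] := Hus.
have vsu : uniq vs by apply: enum_uniq.
have Bvs : {subset cover B <= vs} by move=> v; rewrite mem_enum.
have lk := linked_index_pairs x0 BE (vs := enum (cover B)).
apply/spansP/idP => [[f [fi fa fc]]|].
  have ef : f @: [set: H] = cover B.
    by apply/eqP; rewrite eqEsubset fc cover_spans.
  have fvs x : f x \in vs by rewrite mem_enum -ef imset_f.
  have -> : size us = size vs.
    rewrite -cardE -ef card_imset // cardsT -(card_uniqP us_uniq).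
    by apply: eq_card => x; rewrite us_full.
  rewrite /spans_pairs eqxx; apply/hasP.
  exists [seq index (f x) vs | x <- us].
    rewrite mem_permutations; apply: uniq_perm; rewrite ?iota_uniq //.
      rewrite map_inj_in_uniq // => x y _ _.
      by move/(index_inj x0 (fvs x) (fvs y)); apply: fi.
    move=> i; rewrite mem_iota add0n /=; apply/mapP/idP => [[x _ ->]|ik].
      by rewrite index_mem.
    have /imsetP[x _ ex] : phi i \in f @: [set: H].
      by rewrite ef -mem_enum mem_nth.
    by exists x; rewrite // -ex index_uniq.
  apply/allP=> -[i j] hij; have /andP[/= iq jq] := allP hs_lt _ hij.
  rewrite !(nth_map y0) // lk ?index_mem // !nth_index // fa //.
  by rewrite adjE !index_uniq // /linked hij.
rewrite /spans_pairs; case: eqP => // eq_q /hasP[w].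
rewrite mem_permutations => pw /allP hw.
have sw : size w = size us by rewrite (perm_size pw) size_iota.
have uw : uniq w by rewrite (perm_uniq pw) iota_uniq.
have ixlt x : (index x us < size us)%N by rewrite index_mem.
have wlt i : (i < size us)%N -> (nth 0%N w i < size vs)%N.
  by move=> iq; have := mem_nth 0%N (_ : i < size w)%N;
    rewrite (perm_mem pw) mem_iota sw; apply.
(* The injection reads the image of each vertex of [H] off the word [w]. *)
exists [ffun x => phi (nth 0%N w (index x us))]; split.
- move=> x y; rewrite !ffunE => /eqP; rewrite !nth_uniq ?wlt ?sw //.
  by move=> /eqP; apply: (index_inj y0); exact: us_full.
- move=> x y; rewrite !ffunE adjE -lk ?wlt // => /orP[/hw //|/hw /=].
  by rewrite /linked orbC.
apply/subsetP=> v; rewrite -mem_enum => vv; apply/imsetP.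
have iw : index v vs \in w by rewrite (perm_mem pw) mem_iota /= index_mem.
have jw : (index (index v vs) w < size us)%N by rewrite -sw index_mem.
exists (nth y0 us (index (index v vs) w)) => //.
by rewrite ffunE index_uniq // !nth_index.
Qed.

End Presentation.

(** * Edge lists of cycles, complete graphs and complete bipartite graphs *)

Definition cycle_pairs n : seq (nat * nat) :=
  [seq (i, i.+1 %% n)%N | i <- iota 0 n].

Lemma ordS_neq n (x : 'I_n) : (1 < n)%N -> x != ordS x.
Proof.
move=> n1; rewrite -val_eqE /=; case: (ltngtP x.+1 n) => [lt|gt|eq].
- by rewrite modn_small //; lia.
- by have := ltn_ord x; lia.
by rewrite eq modnn; lia.
Qed.

Lemma ordSS_neq n (x : 'I_n) : (2 < n)%N -> x != ordS (ordS x).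
Proof.
move=> n2; rewrite -val_eqE /=; case: (ltngtP x.+1 n) => [lt|gt|eq].
- rewrite (modn_small lt); case: (ltngtP x.+2 n) => [lt2|gt|eq2]; last first.
  + by rewrite eq2 modnn; lia.
  + by lia.
  by rewrite modn_small //; lia.
- by have := ltn_ord x; lia.
by rewrite eq modnn modn_small //; lia.
Qed.

Lemma cycle_two_neighbours n : (2 < n)%N -> two_neighbours (cycle_graph n).
Proof.
move=> n2 x; exists (ordS x), (ord_pred x).
have n1 : (1 < n)%N by apply: ltn_trans n2.
rewrite /adj /= !/cycle_adj /= eqxx; split.
- by rewrite -(inj_eq (can_inj (@ordSK n))) ord_predK eq_sym ordSS_neq.
- by rewrite ordS_neq.
rewrite -(inj_eq (can_inj (@ordSK n))) ord_predK eq_sym ordS_neq //=.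
by rewrite -[X in _ || (_ == X)]/(val (ordS (ord_pred x))) ord_predK eqxx orbT.
Qed.

Lemma mem_cycle_pairs n i j : (i < n)%N ->
  ((i, j) \in cycle_pairs n) = (j == i.+1 %% n)%N.
Proof.
move=> lt_in; apply/mapP/eqP => [[i' _ [ei ->]]|->]; first by rewrite ei.
by exists i; rewrite // mem_iota.
Qed.

Lemma cycle_presents n : (2 < n)%N ->
  @presents (cycle_graph n) (cycle_pairs n) (enum 'I_n).
Proof.
move=> n2; split=> [|x||x y]; rewrite ?enum_uniq ?mem_enum ?size_enum_ord //.
  apply/allP=> e /mapP[i]; rewrite mem_iota => lt_in ->/=.
  by move: lt_in; rewrite ltn_mod; lia.
rewrite !index_enum_ord /linked !mem_cycle_pairs // /adj /= /cycle_adj /=.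
rewrite andb_idl // => adj_xy; have n1 : (1 < n)%N by apply: ltn_trans n2.
apply: contraTneq adj_xy => ->; rewrite orbb.
by have := ordS_neq y n1; rewrite -val_eqE.
Qed.

Lemma complete_two_neighbours n :
  (2 < n)%N -> two_neighbours (complete_graph n).
Proof.
move=> n2 x; exists (ordS x), (ordS (ordS x)).
have n1 : (1 < n)%N by apply: ltn_trans n2.
by rewrite /adj /= !/complete_adj /= ordSS_neq // !ordS_neq.
Qed.

Lemma complete_presents n : @presents (complete_graph n) (pairs n) (enum 'I_n).
Proof.
split=> [|x||x y]; rewrite ?enum_uniq ?mem_enum ?size_enum_ord //.
  by apply/allP=> -[i j]; rewrite mem_pairs /= => /andP[ij jn];
    rewrite jn (ltn_trans ij).
rewrite !index_enum_ord /linked !mem_pairs !ltn_ord !andbT.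
rewrite /adj /= /complete_adj /=.
by rewrite -val_eqE neq_ltn.
Qed.

Definition bipartite_pairs m n : seq (nat * nat) :=
  [seq (i, m + j)%N | i <- iota 0 m, j <- iota 0 n].

Lemma bipartite_two_neighbours m n : (1 < m)%N -> (1 < n)%N ->
  two_neighbours (complete_bipartite m n).
Proof.
case: m => [|[|m]] // _; case: n => [|[|n]] // _ [x|x].
  by exists (inr ord0), (inr ord_max).
by exists (inl ord0), (inl ord_max).
Qed.

Lemma mem_bipartite_pairs m n i j :
  ((i, j) \in bipartite_pairs m n) = (i < m <= j)%N && (j < m + n)%N.
Proof.
apply/allpairsP/idP => [[[i' j'] /=]|].
  by rewrite !mem_iota => -[lt_i lt_j [-> ->]]; lia.
move=> lt_ij; exists (i, j - m)%N; rewrite /= !mem_iota.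
by split; [lia | lia | congr (_, _); lia].
Qed.

Definition bipartite_enum m n : seq (complete_bipartite m n) :=
  [seq inl i | i <- enum 'I_m] ++ [seq inr j | j <- enum 'I_n].

Lemma size_bipartite_enum m n : size (bipartite_enum m n) = (m + n)%N.
Proof. by rewrite size_cat (size_map inl) (size_map inr) !size_enum_ord. Qed.

Lemma bipartite_presents m n :
  @presents (complete_bipartite m n) (bipartite_pairs m n) (bipartite_enum m n).
Proof.
have inlI : injective (@inl 'I_m 'I_n) by move=> ? ? [].
have inrI : injective (@inr 'I_m 'I_n) by move=> ? ? [].
have nin (j : 'I_n) : (inr j \in [seq inl i | i <- enum 'I_m]) = false.
  by apply/mapP=> -[].
have szl : size [seq (inl i : 'I_m + 'I_n) | i <- enum 'I_m] = m.
  by rewrite size_map size_enum_ord.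
split=> [|x||x y].
- rewrite cat_uniq (map_inj_uniq inlI) (map_inj_uniq inrI) !enum_uniq andbT /=.
  by apply/hasPn=> _ /mapP[j _ ->]; rewrite /= nin.
- by case: x => i; rewrite mem_cat map_f ?mem_enum // orbT.
- rewrite size_bipartite_enum; apply/allP=> -[i j].
  by rewrite mem_bipartite_pairs /=; lia.
have ixl i : index (inl i) (bipartite_enum m n) = i.
  by rewrite /bipartite_enum index_cat map_f ?mem_enum //;
    rewrite (index_map inlI) index_enum_ord.
have ixr j : index (inr j) (bipartite_enum m n) = (m + j)%N.
  by rewrite /bipartite_enum index_cat nin (index_map inrI) index_enum_ord szl.
rewrite /linked !mem_bipartite_pairs.
case: x y => [i|i] [j|j]; rewrite ?ixl ?ixr /adj /=;
  have := ltn_ord i; have := ltn_ord j; lia.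
Qed.

(** * Evaluation of the small cases *)

(** All labelled graphs with [n] edges and minimum degree two are tested; by [min_degree2_size] they
    have at most [n] vertices. The conditional spares the costly comparison for all other graphs. *)
Definition beta_check (n : nat) (ind : nat -> seq (nat * nat) -> int) : bool :=
  all (fun k =>
    all (fun ps =>
      if min_degree2 k ps then - table_alt (iota 0 k) 0 ps == ind k ps
      else true)
      (combs (pairs k) n))
    (iota 0 n.+1).

Definition spans_cycle n k ps : int := spans_pairs (cycle_pairs n) n k ps.

Lemma beta_check3 : beta_check 3 (spans_cycle 3).
Proof. by vm_compute. Qed.

Lemma beta_check4 : beta_check 4 (spans_cycle 4).
Proof. by vm_compute. Qed.

(** Only C_5 and K_4 minus an edge have five edges and minimum degree two; rank 3 singles out the
    latter. *)
Lemma beta_check5 : beta_check 5 (fun k ps =>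
  spans_cycle 5 k ps - (table_rank (iota 0 k) 0 ps == 3 : nat)%:Z).
Proof. by vm_compute. Qed.

(** The graphs that arise are C_6, the 5-cycle with a chord, K_{3,2}, K_4, and two triangles that
    are disjoint or share a vertex; the last two have value 0. *)
Lemma beta_check6 : beta_check 6 (fun k ps =>
  spans_cycle 6 k ps + 2 * (spans_pairs (pairs 4) 4 k ps : nat)%:Z
  - spans_cycle 5 k ps - (spans_pairs (bipartite_pairs 3 2) 5 k ps : nat)%:Z).
Proof. by vm_compute. Qed.

(** A graph of rank 2 is, up to isolated vertices, a forest of two edges or a triangle, so it has at
    most three edges. *)
Lemma four_edges_rank_check :
  all (fun k => all (fun ps => table_rank (iota 0 k) 0 ps != 2)
                  (combs (pairs k) 4)) (iota 0 5).
Proof. by vm_compute. Qed.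

Local Notation bZ b := ((b : nat)%:Z).

Section Main.
Variables (R : realFieldType) (G : sgraph) (x0 : G).
Implicit Types B : {set {set G}}.
Local Notation E := (edges G).
Local Notation vs B := (enum (cover B)).
Local Notation ps B := (index_pairs x0 (vs B) B).

Lemma beta_checkP n ind B : beta_check n ind -> B \subset E -> #|B| = n ->
  ~~ pendant B -> - rank_alt_sum B = ind (size (vs B)) (ps B).
Proof.
move=> chk BE cB npB.
have vsu : uniq (vs B) by apply: enum_uniq.
have Bvs : {subset cover B <= vs B} by move=> v; rewrite mem_enum.
have deg : min_degree2 (size (vs B)) (ps B).
  by apply: index_pairs_min_degree2 => // v; rewrite mem_enum.
have := min_degree2_size deg; rewrite size_index_pairs // cB => le_kn.
have /(allP chk)/allP/(_ (ps B)) : size (vs B) \in iota 0 n.+1.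
  by rewrite mem_iota.
rewrite -cB index_pairs_combs // deg rank_alt_sum_index_pairs //.
by move/(_ isT)/eqP.
Qed.

(** Deleting a pendant edge would leave four edges of rank 2. By [card_cover_rk] these cover at most
    four vertices, which [four_edges_rank_check] excludes. *)
Lemma rank3_edges5_no_pendant B : B \subset E -> #|B| = 5 -> rk B = 3 ->
  ~~ pendant B.
Proof.
move=> BE cB rB; apply/negP=> /(pendant_rk BE)[b bB /(_ _ (subxx _))].
rewrite setD1K // rB => -[/esym rB'].
set B' := B :\ b in rB'.
have cB' : #|B'| = 4 by move: cB; rewrite (cardsD1 b) bB => -[].
have B'E : B' \subset E by apply: subset_trans (subsetDl _ _) BE.
have vsu : uniq (vs B') by apply: enum_uniq.
have Bvs : {subset cover B' <= vs B'} by move=> v; rewrite mem_enum.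
have := card_cover_rk B'E; rewrite rB' cardE => le4.
have /(allP four_edges_rank_check)/allP/(_ (ps B')) : size (vs B') \in iota 0 5.
  by rewrite mem_iota.
have := index_pairs_combs x0 vsu B'E Bvs; rewrite cB' => inB /(_ inB).
by rewrite rk_index_pairs // rB'.
Qed.

(** [F] is the intended summand and [ind] its computable form. The evaluation settles the sets
    without pendant edge; on the pendant ones both summands are 0. *)
Lemma mst_coef_sum n (F : {set {set G}} -> int) ind : (1 < n)%N ->
  beta_check n ind ->
  (forall B, B \subset E -> #|B| = n -> ind (size (vs B)) (ps B) = F B) ->
  (forall B, B \subset E -> #|B| = n -> pendant B -> F B = 0) ->
  mst_coef R G n = (\sum_(B in powerset E | #|B| == n) F B)%:~R.
Proof.
move=> n1 chk indF F0; rewrite mst_coefE ?(ltn_trans _ n1) //.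
congr (_%:~R); apply: eq_bigr => B /andP[]; rewrite inE => BE /eqP cB.
have [pB|npB] := boolP (pendant B).
  by rewrite rank_alt_sum_pendant ?cB // F0 // oppr0.
by rewrite (beta_checkP chk) // indF.
Qed.

Lemma sum_card n (P : pred {set {set G}}) :
  \sum_(B in powerset E | #|B| == n) bZ (P B)
    = #|[set B in powerset E | (#|B| == n) && P B]|%:Z.
Proof.
rewrite -sum1_card (big_morph Posz PoszD (erefl _)).
rewrite [RHS](eq_bigl (fun B => ((B \in powerset E) && (#|B| == n)) && P B)).
  by rewrite [RHS]big_mkcondr; apply: eq_bigr => B _; case: (P B).
by move=> B; rewrite inE andbA.
Qed.

Lemma spans_cycleE n B : (2 < n)%N -> B \subset E ->
  spans_cycle n (size (vs B)) (ps B) = bZ (spans (cycle_graph n) B).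
Proof.
case: n => // n n2 BE.
rewrite (spansE (ord0 : cycle_graph n.+1) (cycle_presents n2)
  (cycle_two_neighbours n2) x0 BE).
by rewrite size_enum_ord.
Qed.

Lemma spans_k4E B : B \subset E ->
  spans (complete_graph 4) B = spans_pairs (pairs 4) 4 (size (vs B)) (ps B).
Proof.
move=> BE; rewrite (spansE (ord0 : complete_graph 4) (complete_presents 4)
  (@complete_two_neighbours 4 isT) x0 BE).
by rewrite size_enum_ord.
Qed.

Lemma spans_k32E B : B \subset E ->
  spans (complete_bipartite 3 2) B
    = spans_pairs (bipartite_pairs 3 2) 5 (size (vs B)) (ps B).
Proof.
move=> BE; rewrite (spansE (inl ord0 : complete_bipartite 3 2)
  (bipartite_presents 3 2) (@bipartite_two_neighbours 3 2 isT isT) x0 BE).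
by rewrite size_bipartite_enum.
Qed.

End Main.

(** * The counts of subgraphs as counts of edge sets *)

Lemma card_edges_cycle n : (2 < n)%N ->
  #|edges (cycle_graph n)|
    = count (fun e => linked (cycle_pairs n) e.1 e.2) (pairs n).
Proof.
case: n => // n n2.
rewrite (card_edges_pairs (ord0 : cycle_graph n.+1) (cycle_presents n2)).
by rewrite size_enum_ord.
Qed.

Lemma card_edges_k4 : #|edges (complete_graph 4)| = 6.
Proof.
rewrite (card_edges_pairs (ord0 : complete_graph 4) (complete_presents 4)).
by rewrite size_enum_ord.
Qed.

Lemma card_edges_k32 : #|edges (complete_bipartite 3 2)| = 6.
Proof.
rewrite (card_edges_pairs (inl ord0 : complete_bipartite 3 2)
  (bipartite_presents 3 2)).
by rewrite size_bipartite_enum.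
Qed.

Lemma num_cyclesE (G : sgraph) n : (2 < n < 7)%N ->
  num_cycles G n
    = #|[set B in powerset (edges G) | (#|B| == n) && spans (cycle_graph n) B]|.
Proof.
case/andP=> n2 n7; rewrite /num_cycles num_copies;
  last exact: cycle_two_neighbours.
rewrite card_edges_cycle //.
suff -> : count (fun e => linked (cycle_pairs n) e.1 e.2) (pairs n) = n by [].
by move: n n2 n7; do 7![case=> //].
Qed.

Lemma num_k4E (G : sgraph) :
  num_k4 G = #|[set B in powerset (edges G) |
                (#|B| == 6)%N && spans (complete_graph 4) B]|.
Proof.
by rewrite /num_k4 num_copies ?card_edges_k4 //; apply: complete_two_neighbours.
Qed.

Lemma num_k32E (G : sgraph) :
  num_k32 G = #|[set B in powerset (edges G) |
                 (#|B| == 6)%N && spans (complete_bipartite 3 2) B]|.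
Proof.
by rewrite /num_k32 num_copies ?card_edges_k32 //;
  apply: bipartite_two_neighbours.
Qed.

Lemma num_c51E (G : sgraph) :
  num_c51 G = #|[set B in powerset (edges G) |
                 (#|B| == 6)%N && spans (cycle_graph 5) B]|.
Proof.
rewrite /num_c51 num_chorded_copies ?card_edges_cycle //.
exact: cycle_two_neighbours.
Qed.

Theorem theorem3p8 (R : realFieldType) (G : sgraph) (connG : connected G) :
  [/\ mst_coef R G 3 = (num_cycles G 3)%:R,
      mst_coef R G 4 = (num_cycles G 4)%:R,
      mst_coef R G 5 = (num_cycles G 5)%:R - (num_k35 G)%:R
    & mst_coef R G 6 = (num_cycles G 6)%:R + 2 * (num_k4 G)%:R
                       - (num_c51 G)%:R - (num_k32 G)%:R].
Proof.
(* A connected graph has a vertex; it serves as the default value of [nth]. *)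
have [x0 _] : exists x0 : G, x0 \in predT by apply/card_gt0P; case: connG.
have c0 n (B : {set {set G}}) : (2 < n)%N -> pendant B ->
    spans (cycle_graph n) B = false.
  move=> n2; apply: contraTF; apply: spans_pendant.
  exact: cycle_two_neighbours.
have coef := mst_coef_sum R (x0 := x0).
split.
- pose F (B : {set {set G}}) := bZ (spans (cycle_graph 3) B).
  rewrite (coef _ F _ _ beta_check3) // => [|B BE _|B _ _ pB].
  + by rewrite sum_card num_cyclesE.
  + by rewrite spans_cycleE.
  by rewrite /F c0.
- pose F (B : {set {set G}}) := bZ (spans (cycle_graph 4) B).
  rewrite (coef _ F _ _ beta_check4) // => [|B BE _|B _ _ pB].
  + by rewrite sum_card num_cyclesE.
  + by rewrite spans_cycleE.
  by rewrite /F c0.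
- pose F (B : {set {set G}}) := bZ (spans (cycle_graph 5) B) - bZ (rk B == 3).
  rewrite (coef _ F _ _ beta_check5) // => [|B BE _|B BE cB pB].
  + by rewrite sumrB !sum_card rmorphB num_cyclesE.
  + rewrite spans_cycleE // rk_index_pairs // ?enum_uniq // => v.
    by rewrite mem_enum.
  (* The rank condition is not stated through [spans], so its vanishing on pendant sets needs its
     own argument. *)
  rewrite /F c0 //; case: eqP => // rB.
  by rewrite (negPf (rank3_edges5_no_pendant x0 BE cB rB)) in pB.
pose F (B : {set {set G}}) := bZ (spans (cycle_graph 6) B)
  + 2 * bZ (spans (complete_graph 4) B) - bZ (spans (cycle_graph 5) B)
  - bZ (spans (complete_bipartite 3 2) B).
rewrite (coef _ F _ _ beta_check6) // => [|B BE _|B _ _ pB].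
- rewrite !sumrB big_split -mulr_sumr /= !sum_card !rmorphB rmorphD rmorphM.
  by rewrite num_cyclesE // num_k4E num_c51E num_k32E.
- by rewrite !spans_cycleE // -(spans_k4E x0 BE) -(spans_k32E x0 BE).
rewrite /F !c0 //.
have -> : spans (complete_graph 4) B = false.
  by apply: contraTF pB; apply/spans_pendant/complete_two_neighbours.
have -> // : spans (complete_bipartite 3 2) B = false.
by apply: contraTF pB; apply/spans_pendant/bipartite_two_neighbours.
Qed.
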